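(* Let $G$ be a finite, simple, connected regular graph with $d+1$ distinct eigenvalues $\lambda_0>\cdots>\lambda_d$, preintersection numbers $\alpha_i,\beta_i,\gamma_i$, and girth $g\ge 2d-2$. Then $$\gamma_d\ge -(\lambda_1+\cdots+\lambda_d),$$ with equality if and only if $G$ is distance-regular and either bipartite or a generalized Odd graph.
   Context: Let $G$ be a finite, simple, connected graph on $n$ vertices with adjacency matrix $A$, whose distinct eigenvalues are $\lambda_0>\cdots>\lambda_d$ with multiplicities $m_0,\ldots,m_d$. On the space $\mathbb{R}_d[x]$ of real polynomials of degree at most $d$ use the scalar product $\langle p,q\rangle_G=\frac1n\operatorname{tr}(p(A)q(A))=\frac1n\sum_{i=0}^d m_i p(\lambda_i)q(\lambda_i)$. The predistance polynomials $p_0,\ldots,p_d$ are the unique orthogonal sequence with $\deg p_i=i$ and $\|p_i\|_G^2=p_i(\lambda_0)$. The preintersection numbers $\alpha_i,\beta_i,\gamma_i$ are the coefficients of the three-term recurrence $xp_i=\beta_{i-1}p_{i-1}+\alpha_ip_i+\gamma_{i+1}p_{i+1}$, $i=0,\ldots,d$, as functions on $\{\lambda_0,\ldots,\lambda_d\}$ (equivalently modulo $\prod_i (x-\lambda_i)$, which matters only for $i=d$), with conventions $\beta_{-1}=\gamma_{d+1}=0$, $p_{-1}=p_{d+1}=0$, $\gamma_0=\beta_d=0$. The girth is the length of a shortest cycle (infinite if there is none); the odd-girth is the length of a shortest odd cycle. For vertices $u,v$ at distance $i$, let $c_i(u,v),a_i(u,v),b_i(u,v)$ be the number of neighbours of $v$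 at distance $i-1$, $i$, $i+1$ from $u$, respectively. A graph of diameter $D$ is distance-regular if for each $i=0,\ldots,D$ these three numbers do not depend on the choice of $u,v$ at distance $i$. A generalized Odd graph is a distance-regular graph with diameter $D$ and odd-girth $2D+1$. *)

(* Defs.v *)
From HB Require Import structures.
From mathcomp Require Import all_boot all_order all_algebra.

Set Implicit Arguments.
Unset Strict Implicit.
Unset Printing Implicit Defensive.

Import Order.TTheory GRing.Theory Num.Theory.

Section Graphs.

Variables (T : finType) (e : rel T).

Definition connected_graph := forall u v : T, connect e u v.

Definition regular_graph := exists k : nat, forall v : T, #|[set w | e v w]| = k.

Definition bipartite_graph :=
  exists X : {set T}, forall u v : T, e u v -> (u \in X) != (v \in X).

(* Length of a shortest walk from u to v; shortest walks have length less than
   #|T|, and the value is #|T| when there is no walk at all. *)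
Definition gdist (u v : T) : nat :=
  find (fun k => [exists p : k.-tuple T, path e u p && (last u p == v)])
       (iota 0 #|T|).

Definition diameter : nat := \max_(u : T) \max_(v : T) gdist u v.

(* The bound 2 < k is needed because ucycle accepts [:: x; y] for an edge xy. *)
Definition has_cycle (k : nat) : bool :=
  (2 < k) && [exists c : k.-tuple T, ucycleb e c].

(* None stands for infinity; a cycle has at most #|T| vertices. *)
Definition girth : option nat :=
  ohead [seq k <- iota 0 #|T|.+1 | has_cycle k].

Definition odd_girth : option nat :=
  ohead [seq k <- iota 0 #|T|.+1 | odd k && has_cycle k].

Definition c_num (u v : T) : nat := #|[set w | e v w & (gdist u w).+1 == gdist u v]|.
Definition a_num (u v : T) : nat := #|[set w | e v w & gdist u w == gdist u v]|.
Definition b_num (u v : T) : nat := #|[set w | e v w & gdist u w == (gdist u v).+1]|.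

Definition distance_regular :=
  connected_graph /\
  forall i : nat, i <= diameter ->
  forall u v u' v' : T, gdist u v = i -> gdist u' v' = i ->
    [/\ c_num u v = c_num u' v', a_num u v = a_num u' v' & b_num u v = b_num u' v'].

Definition generalized_odd_graph :=
  distance_regular /\ odd_girth = Some (diameter.*2.+1).

End Graphs.

Local Open Scope ring_scope.

Section Spectrum.

Variables (R : rcfType) (n : nat) (e : rel 'I_n.+1).

Definition adjmx : 'M[R]_n.+1 := \matrix_(i, j) (e i j)%:R.

(* lam lists the distinct eigenvalues of the graph in decreasing order. *)
Definition distinct_spectrum (d : nat) (lam : 'I_d.+1 -> R) :=
  (forall i j : 'I_d.+1, (i < j)%N -> lam j < lam i) /\
  (forall a : R, eigenvalue adjmx a <-> exists i : 'I_d.+1, lam i = a).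

Definition gprod (p q : {poly R}) : R :=
  n.+1%:R^-1 * \tr (horner_mx adjmx p *m horner_mx adjmx q).

(* Only p 0, ..., p d are constrained. *)
Definition predistance_polynomials (d : nat) (lam : 'I_d.+1 -> R)
    (p : nat -> {poly R}) :=
  [/\ forall i : nat, (i <= d)%N -> size (p i) = i.+1,
      forall i j : nat, (i <= d)%N -> (j <= d)%N -> i <> j ->
        gprod (p i) (p j) = 0
    & forall i : nat, (i <= d)%N -> gprod (p i) (p i) = (p i).[lam ord0]].

End Spectrum.

(* The recurrence x p_i = beta_(i-1) p_(i-1) + alpha_i p_i + gamma_(i+1) p_(i+1)
   as an equality of functions on the points lam 0, ..., lam d; the conventions
   p_(-1) = p_(d+1) = 0 and beta_(-1) = gamma_(d+1) = 0 are rendered by dropping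
   the first term for i = 0 and the last one for i = d. *)
Definition preintersection_numbers (R : rcfType) (d : nat)
    (lam : 'I_d.+1 -> R) (p : nat -> {poly R}) (alpha beta gamma : nat -> R) :=
  [/\ gamma 0%N = 0, beta d = 0
    & forall (i : nat) (j : 'I_d.+1), (i <= d)%N ->
        lam j * (p i).[lam j] =
          (if i is i'.+1 then beta i' * (p i').[lam j] else 0)
          + alpha i * (p i).[lam j]
          + (if (i < d)%N then gamma i.+1 * (p i.+1).[lam j] else 0)].

(* Main.v *)
Require Import Defs.
From mathcomp Require Import all_boot all_order all_algebra.
From mathcomp Require Import zify ring lra complex.

Set Implicit Arguments.
Unset Strict Implicit.
Unset Printing Implicit Defensive.

Import Order.TTheory GRing.Theory Num.Theory.

(* The trace of multiplication by x modulo the minimal polynomial of A gives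
   alpha_0 + ... + alpha_d = lambda_0 + ... + lambda_d, and evaluating the last
   recurrence at lambda_0 gives alpha_d + gamma_d = lambda_0; hence gamma_d equals
   -(lambda_1 + ... + lambda_d) plus the sum of alpha_i over i < d.
   Since g >= 2d - 2, geodesics of length at most d - 2 are unique and no edge joins
   two vertices at the same distance at most d - 2 from a third one.  By induction
   p_i(A) is then the distance-i matrix and alpha_i = 0 for i <= d - 2, while
   P = p_(d-1)(A) is supported on the pairs at distance d - 1, with entries of
   constant sign.  So alpha_(d-1), a positive multiple of <AP, P>, is nonnegative,
   and it vanishes iff no edge is "flat", i.e. joins two vertices at the same
   distance d - 1 from a third one.
   In that case the recurrence for i = d - 1 and p_0(A) + ... + p_d(A) = J (Hoffman)
   force p_i(A) to be the distance-i matrix for all i <= d, so G is distance-regular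
   of diameter d, and its odd cycles, if any, have length at least 2d + 1, with
   equality for the shortest one.  Conversely, bipartite graphs have no flat edge,
   and a flat edge in a generalized Odd graph would bound the diameter by d - 1,
   making p_d(A) proportional to p_(d-1)(A). *)

(** * Distances, geodesics and cycles *)

Section GraphDistance.

Variables (T : finType) (e : rel T).
Hypotheses (e_sym : symmetric e) (e_conn : connected_graph e).

Lemma gdist_path_le u p : path e u p -> gdist e u (last u p) <= size p.
Proof.
(* A path of [#|T|] or more edges satisfies the bound because [find] never exceeds the length of the
   list it searches. *)
move=> up; case: (ltnP (size p) #|T|) => [lt|le]; last first.
  by apply: leq_trans le; rewrite -[X in _ <= X](size_iota 0); apply: find_size.
rewrite leqNgt; apply/negP => /(before_find 0); rewrite nth_iota //= add0n.
by case/existsP; exists (in_tuple p); rewrite up eqxx.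
Qed.

(** A shortened path has distinct vertices, hence fewer than [#|T|] edges, so the search in [gdist]
    succeeds. *)
Lemma gdistP u v : exists p, [/\ path e u p, last u p = v & size p = gdist e u v].
Proof.
have /connectP [p0 up0 vE] := e_conn u v; case/shortenP: up0 vE => p up Up _ ->.
set P := (fun k => [exists q : k.-tuple T, path e u q && (last u q == last u p)]).
have hP : has P (iota 0 #|T|).
  apply/hasP; exists (size p); last by apply/existsP; exists (in_tuple p); rewrite up eqxx.
  by rewrite mem_iota /= add0n; move/card_uniqP: Up => /= <-; apply: max_card.
have := nth_find 0 hP; rewrite nth_iota -1?[X in _ < X](size_iota 0) -?has_find //.
rewrite add0n => /existsP [q /andP[uq /eqP ql]]; exists q; split=> //.
by rewrite size_tuple.
Qed.

Lemma gdistxx u : gdist e u u = 0.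
Proof. by apply/eqP; rewrite -leqn0; apply: (@gdist_path_le u [::]). Qed.

Lemma gdist_eq0 u v : (gdist e u v == 0) = (u == v).
Proof.
apply/eqP/eqP => [d0|->]; last exact: gdistxx.
by have [[|x p] [_ lp]] := gdistP u v; rewrite d0.
Qed.

Lemma gdist_sym u v : gdist e u v = gdist e v u.
Proof.
wlog suff : u v / gdist e u v <= gdist e v u.
  by move=> H; apply/eqP; rewrite eqn_leq !H.
have [p [vp lp <-]] := gdistP v u.
have up : path e u (rev (belast v p)).
  by rewrite -lp rev_path; under eq_path do rewrite e_sym.
have -> : v = last u (rev (belast v p)).
  by case: {vp up} p lp => [|x p] //=; rewrite rev_cons last_rcons.
by apply: leq_trans (gdist_path_le up) _; rewrite size_rev size_belast.
Qed.

Lemma gdist_edge u v w : e v w -> gdist e u w <= (gdist e u v).+1.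
Proof.
move=> vw; have [p [up lp <-]] := gdistP u v.
have : path e u (rcons p w) by rewrite rcons_path up lp.
by move/gdist_path_le; rewrite last_rcons size_rcons.
Qed.

Lemma gdist_pred u v i : gdist e u v = i.+1 -> exists2 w, e v w & gdist e u w = i.
Proof.
move=> duv; have [p [up lp sp]] := gdistP u v.
case/lastP: p => [|p x] in up lp sp *; first by rewrite duv in sp.
rewrite last_rcons in lp; rewrite size_rcons duv in sp; case: sp => sp.
move: up; rewrite {x}lp rcons_path => /andP[up wv].
exists (last u p); first by rewrite e_sym.
apply/eqP; rewrite eqn_leq; have := gdist_path_le up; rewrite sp => -> /=.
by have := gdist_edge u wv; rewrite duv.
Qed.

Lemma gdist_parity_edge u v w : e v w -> gdist e u v != gdist e u w ->
  odd (gdist e u w) = ~~ odd (gdist e u v).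
Proof.
move=> vw; have := gdist_edge u vw; rewrite e_sym in vw.
have := gdist_edge u vw; lia.
Qed.

Lemma leq_diameter u v : gdist e u v <= diameter e.
Proof.
by apply: leq_trans (leq_bigmax u); apply: (leq_bigmax (F := fun v => gdist e u v)).
Qed.

Lemma diameter_leq D : (forall u v, gdist e u v <= D) -> diameter e <= D.
Proof. by move=> H; apply/bigmax_leqP => u _; apply/bigmax_leqP. Qed.

(** * Cycles, girth and forks of geodesics *)

Lemma has_cycle_ucycle c : 2 < size c -> ucycle e c -> has_cycle e (size c).
Proof.
move=> c2 ec; rewrite /has_cycle c2; apply/existsP; exists (in_tuple c) => /=.
exact: ec.
Qed.

Lemma has_cycle_leq k : has_cycle e k -> k <= #|T|.
Proof.
case/andP=> _ /existsP[c /andP[_ Uc]].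
by rewrite -(size_tuple c) -(card_uniqP Uc); apply: max_card.
Qed.

(** The filtered list stays sorted, so its head is its least element; this serves both [girth] and
    [odd_girth]. *)
Lemma ohead_filter_iota (P : pred nat) m k : k < m -> P k ->
  exists g, [/\ ohead [seq i <- iota 0 m | P i] = Some g, P g & g <= k].
Proof.
move=> km Pk; have : k \in [seq i <- iota 0 m | P i].
  by rewrite mem_filter Pk mem_iota.
have : sorted leq [seq i <- iota 0 m | P i].
  by apply: sorted_filter; [apply: leq_trans | apply: iota_sorted].
have : forall g, g \in [seq i <- iota 0 m | P i] -> P g.
  by move=> g; rewrite mem_filter => /andP[].
case: [seq _ <- _ | _] => [//|g s] /= Ps gs; exists g; split=> //.
  by apply: Ps; rewrite mem_head.
move: H; rewrite inE => /orP[/eqP-> //|]; move: k {km Pk}.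
by apply/allP; apply: order_path_min gs; apply: leq_trans.
Qed.

Lemma girth_leq k : has_cycle e k -> exists2 g, girth e = Some g & g <= k.
Proof.
move=> ck; have [|g [? _ ?]] := @ohead_filter_iota (has_cycle e) #|T|.+1 k _ ck.
  by rewrite ltnS has_cycle_leq.
by exists g.
Qed.

Lemma odd_girth_leq k : odd k -> has_cycle e k ->
  exists g, [/\ odd_girth e = Some g, odd g, has_cycle e g & g <= k].
Proof.
move=> ok ck; have [||g [? /andP[] ? ? ?]] :=
  @ohead_filter_iota (fun k => odd k && has_cycle e k) #|T|.+1 k.
- by rewrite ltnS has_cycle_leq.
- by rewrite ok.
by exists g.
Qed.

(** The cycle runs from [z] along [p], crosses the edge between the two ends and returns along [q]
    reversed. *)
Lemma has_cycle_fork z p q : path e z p -> path e z q ->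
  e (last z p) (last z q) -> uniq (z :: p ++ q) -> 0 < size q ->
  1 < size p + size q -> has_cycle e (size p + size q).+1.
Proof.
move=> zp; case/lastP: q => [//|q w]; rewrite last_rcons => zq pw U _ s2.
have -> : (size p + size (rcons q w)).+1 = size (z :: p ++ w :: rev q).
  by rewrite /= size_cat size_rcons /= size_rev.
apply: has_cycle_ucycle.
  by move: s2; rewrite /= size_cat size_rcons /= size_rev.
apply/andP; split; last first.
  rewrite -(perm_uniq (s1 := z :: p ++ rcons q w)) // perm_cons perm_cat2l.
  by rewrite perm_rcons perm_cons perm_sym perm_rev.
rewrite /= rcons_cat cat_path zp /= pw /= -rev_cons.
by rewrite -[z :: q]/(z :: q) -(belast_rcons z q w) -{1}(last_rcons z q w) rev_path;
  under eq_path do rewrite e_sym.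
Qed.

(* Following geodesics to [u] back from [w] and [w'] until they first meet, in [z]. *)
Lemma geodesic_fork u j w w' : gdist e u w = j -> gdist e u w' = j -> w != w' ->
  exists z p p',
    [/\ path e z p, path e z p', last z p = w & last z p' = w'] /\
    [/\ size p' = size p, 0 < size p <= j, uniq (z :: p ++ p')
      & all (fun x => gdist e u x <= j) (z :: p ++ p')].
Proof.
elim: j w w' => [|j IH] w w' dw dw' ww'.
  by move: ww'; move/eqP: dw; move/eqP: dw'; rewrite !gdist_eq0 => /eqP<- /eqP<-; rewrite eqxx.
have [x wx dx] := gdist_pred dw; have [x' wx' dx'] := gdist_pred dw'.
rewrite e_sym in wx; rewrite e_sym in wx'.
have neqd a b : gdist e u a <= j -> gdist e u b = j.+1 -> a != b.
  by move=> da db; apply: contraTneq da => ->; rewrite db ltnn.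
(* Equal predecessors close the fork at once; otherwise the fork of the predecessors is prolonged by
   one edge on each side. *)
have [xx'|xx'] := eqVneq x x'.
  exists x, [:: w], [:: w']; rewrite -xx' in wx'; split; split; rewrite /= ?wx ?wx' //.
    by rewrite !inE !negb_or ww' !neqd ?dx.
  by rewrite dw dw' dx !leqnn leqnSn.
have [z [p [p' [[zp zp' lp lp'] [sp' sp U A]]]]] := IH x x' dx dx' xx'.
exists z, (rcons p w), (rcons p' w'); rewrite !rcons_path zp zp' lp lp' wx wx' !last_rcons.
rewrite !size_rcons sp'; split=> //; split=> //.
- by case/andP: sp.
(* The new ends lie at distance [j.+1] from [u], beyond every vertex of the fork found so far. *)
- have nin a : gdist e u a = j.+1 -> a \notin z :: p ++ p'.
    by move=> da; apply/negP => /(allP A) /=; rewrite da ltnn.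
  have nw := nin w dw; have nw' := nin w' dw'.
  rewrite (perm_uniq (s2 := [:: w, w' & z :: p ++ p'])).
    by rewrite cons_uniq [uniq (w' :: _)]cons_uniq U inE negb_or ww' nw nw'.
  by apply/permP => a; rewrite -!cats1 /= !count_cat /=; lia.
move: A; rewrite /= !all_cat !all_rcons /= dw dw' leqnn /= => /and3P[A1 A2 A3].
apply/and3P; split; first exact: leqW.
  by apply: sub_all A2 => ?; apply: leqW.
by apply: sub_all A3 => ?; apply: leqW.
Qed.

(** * Flat edges, odd cycles and bipartiteness *)

Definition flat_edge i :=
  [exists u, exists v, exists w,
     [&& e v w, gdist e u v == i & gdist e u w == i]].

Lemma flat_edgeP i :
  reflect (exists u v w, [/\ e v w, gdist e u v = i & gdist e u w = i]) (flat_edge i).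
Proof.
apply: (iffP existsP) => [[u /existsP[v /existsP[w /and3P[? /eqP ? /eqP ?]]]]|].
  by exists u, v, w.
case=> [u [v [w [vw /eqP dv /eqP dw]]]]; exists u; apply/existsP; exists v.
by apply/existsP; exists w; apply/and3P.
Qed.

(** The edge closes a fork with two arms of equal length at most [i]. *)
Lemma flat_edge_cycle i : irreflexive e -> flat_edge i ->
  exists k, [/\ has_cycle e k, odd k & k <= i.*2.+1].
Proof.
move=> e_irr /flat_edgeP [u [v [w [vw dv dw]]]].
have nvw : v != w by apply: contraTneq vw => ->; rewrite e_irr.
have [z [p [q [[zp zq lp lq] [sq /andP[sp0 spi] U _]]]]] := geodesic_fork dv dw nvw.
exists (size p + size q).+1; split.
- by apply: (has_cycle_fork zp zq); rewrite ?lp ?lq ?sq //; lia.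
- by rewrite sq addnn /= odd_double.
- by rewrite sq addnn ltnS leq_double.
Qed.

(** The fork ending in the two predecessors is closed through [v], which is farther from [u] than
    the whole fork. *)
Lemma two_pred_cycle u v w w' i : w != w' -> e v w -> e v w' ->
  gdist e u v = i.+1 -> gdist e u w = i -> gdist e u w' = i ->
  exists2 k, has_cycle e k & k <= i.+1.*2.
Proof.
move=> ww' vw vw' dv dw dw'.
have [z [p [q [[zp zq lp lq] [sq /andP[sp0 spi] U A]]]]] := geodesic_fork dw dw' ww'.
exists (size (rcons p v) + size q).+1; last first.
  by rewrite size_rcons sq; lia.
have nv : v \notin z :: p ++ q.
  by apply/negP => /(allP A); rewrite dv ltnn.
apply: (@has_cycle_fork z); rewrite ?last_rcons ?lq ?size_rcons ?sq //; last by lia.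
  by rewrite rcons_path zp lp e_sym.
rewrite (perm_uniq (s2 := v :: z :: p ++ q)) 1?cons_uniq ?nv //.
by rewrite -cats1; apply/permP => a /=; rewrite !count_cat /=; lia.
Qed.

(** Without flat edges up to distance [l], the parity of the distance to a vertex [u] of the cycle
    would flip along each edge, which is impossible around an odd cycle. *)
Lemma odd_cycle_flat_edge k l : odd k -> has_cycle e k -> k <= l.*2.+1 ->
  exists2 i, i <= l & flat_edge i.
Proof.
move=> ok /andP[_ /existsP[c /andP[ec _]]] kl; rewrite -(size_tuple c) in ok kl.
case: (tval c) ec ok kl => [//|u p] /= ec ok kl {c}.
(* The two arcs from [u] to [x] have total length at most [l.*2.+1], so the shorter one has length
   at most [l]. *)
have le_l x : x \in p -> gdist e u x <= l.
  move=> xp; case/splitPr: xp ec ok kl => p1 p2 + _ kl.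
  have kl' : (size p1).+1 + (size p2).+1 <= l.*2.+1.
    by move: kl; rewrite size_cat /=; lia.
  rewrite rcons_cat -cat_rcons cat_path last_rcons => /andP[/gdist_path_le].
  rewrite last_rcons size_rcons => d1 /gdist_path_le.
  by rewrite last_rcons size_rcons (gdist_sym x u) => d2; move: (size p1) (size p2) kl' d1 d2 => s1 s2; lia.
have [/existsP[i fi]|noflat] := boolP [exists i : 'I_l.+1, flat_edge i].
  by exists i => //; rewrite -ltnS ltn_ord.
have parity x q : path e x q -> all (fun y => gdist e u y <= l) (x :: q) ->
    odd (gdist e u (last x q)) = odd (gdist e u x) (+) odd (size q).
  elim: q x => [|y q IH] x /=; first by rewrite addbF.
  move=> /andP[xy yq] /and3P[xl yl ql]; rewrite IH //= ?yl //.
  rewrite (@gdist_parity_edge u x y) //; first by rewrite addbN addNb.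
  apply: contraNneq noflat => dxy; apply/existsP.
  have xl' : gdist e u x < l.+1 by rewrite ltnS.
  by exists (Ordinal xl'); apply/flat_edgeP; exists u, x, y.
have := parity u (rcons p u) ec.
rewrite last_rcons gdistxx /= size_rcons all_rcons gdistxx /= ok => flip.
by suff: false = true by []; apply/flip/allP.
Qed.

(** The parity of the distance from [u] tells the two colour classes apart, and the ends of an edge
    differ in colour. *)
Lemma bipartite_flat_edge i : bipartite_graph e -> ~~ flat_edge i.
Proof.
case=> X eX; apply/negP => /flat_edgeP [u [v [w [vw dv dw]]]].
have color x : odd (gdist e u x) = (u \in X) (+) (x \in X).
  have [p [up <- <-]] := gdistP u x; elim: p u up {v w vw dv dw} => [|y p IH] u /=.
    by rewrite addbb.
  by case/andP=> /eX uy /IH ->; move: uy; do 3!case: (_ \in X).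
have := eX v w vw; have := color v; rewrite dv -dw color.
by do 3!case: (_ \in X).
Qed.

Lemma flat_edgeN_bipartite (u0 : T) : (forall i, ~~ flat_edge i) -> bipartite_graph e.
Proof.
move=> noflat; exists [set v | odd (gdist e u0 v)] => u v uv; rewrite !inE.
rewrite (@gdist_parity_edge u0 u v) //; first by case: odd.
apply: contraNneq (noflat (gdist e u0 u)) => duv; apply/flat_edgeP.
by exists u0, u, v.
Qed.

(** A common form of [c_num], [a_num] and [b_num]; these counts are the entries of a distance matrix
    times the adjacency matrix. *)
Definition sphere_num u v j := #|[set w | e v w & gdist e u w == j]|.

Lemma c_numE u v i : gdist e u v = i.+1 -> c_num e u v = sphere_num u v i.
Proof. by rewrite /c_num => ->. Qed.

Lemma a_numE u v i : gdist e u v = i -> a_num e u v = sphere_num u v i.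
Proof. by rewrite /a_num => ->. Qed.

Lemma b_numE u v i : gdist e u v = i -> b_num e u v = sphere_num u v i.+1.
Proof. by rewrite /b_num => ->. Qed.

Lemma c_num0 u v : gdist e u v = 0 -> c_num e u v = 0.
Proof. by rewrite /c_num => ->; apply: eq_card0 => w; rewrite !inE andbF. Qed.

Lemma c_num_gt0 u v i : gdist e u v = i.+1 -> 0 < c_num e u v.
Proof.
move=> duv; have [w vw dw] := gdist_pred duv; apply/card_gt0P; exists w.
by rewrite inE vw dw duv eqxx.
Qed.

Lemma flat_edgeN_a_num u v : ~~ flat_edge (gdist e u v) -> a_num e u v = 0.
Proof.
move=> noflat; apply: eq_card0 => w; rewrite !inE; apply: contraNF noflat.
by case/andP=> vw /eqP dw; apply/flat_edgeP; exists u, v, w.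
Qed.

Lemma sphere_num_far u v j : j.+1 < gdist e u v \/ (gdist e u v).+1 < j ->
  sphere_num u v j = 0.
Proof.
move=> far; apply: eq_card0 => w; rewrite !inE; apply/negP => /andP[vw /eqP dw].
have := gdist_edge u vw; rewrite e_sym in vw; have := gdist_edge u vw.
by rewrite dw; lia.
Qed.

Lemma card_neighbours u v :
  #|[set w | e v w]| = c_num e u v + a_num e u v + b_num e u v.
Proof.
have cardE (P : pred T) : #|[set w | P w]| = \sum_w P w.
  by rewrite -sum1dep_card big_mkcond; apply: eq_bigr => w _; case: (P w).
rewrite /c_num /a_num /b_num !cardE -!big_split /=; apply: eq_bigr => w _.
have [vw|//] := boolP (e v w); have := gdist_edge u vw.
rewrite e_sym in vw; have := gdist_edge u vw => /=.
by move: (gdist e u v) (gdist e u w) => a b; do 3!case: eqP => /=; lia.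
Qed.

End GraphDistance.

Local Open Scope ring_scope.

(** * Symmetric matrices and the adjacency matrix *)

(* Over [R[i]] the matrix [A] is diagonalizable with real eigenvalues. *)
Lemma symmetric_horner_mx_eq0 (R : rcfType) n (A : 'M[R]_n.+1) (q : {poly R}) :
  A^T = A -> (forall a, eigenvalue A a -> root q a) -> horner_mx A q = 0.
Proof.
move=> A_sym qA; pose f := real_complex R; pose B : 'M[R[i]]_n.+1 := map_mx f A.
have B_herm : B \is hermsymmx.
  apply: realsym_hermsym.
    apply/is_hermitianmxP; rewrite expr0 scale1r map_mx_id //.
    by rewrite /B map_trmx A_sym.
  by apply/mxOverP => i j; rewrite mxE; apply/complex_realP; exists (A i j).
have D_real := hermitian_spectral_diag_real B_herm.
have /hermitian_normalmx/orthomx_spectralP BE := B_herm.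
set P := spectralmx B in BE; set D := spectral_diag B in BE D_real.
have P_unit : P \in unitmx by apply: spectral_unit.
apply: (map_mx_inj (f := f)); rewrite map_mx0 map_horner_mx -/B BE.
rewrite horner_mx_uconjC // horner_mx_diag.
suff -> : map_mx (horner (map_poly f q)) D = 0 by rewrite raddf0 mulmx0 mul0mx.
apply/matrixP => i j; rewrite !mxE ord1 {i}.
have /complex_realP [a aE] := mxOverP D_real 0 j.
have {}aE : D 0 j = f a by [].
rewrite aE horner_map (rootP (qA a _)) ?raddf0 //.
rewrite eigenvalue_root_char -(fmorph_root f) map_char_poly -/B.
(* The eigenvector is a row of the invertible matrix [P] that diagonalizes [B]; a zero row would
   make its determinant vanish. *)
rewrite -eigenvalue_root_char; apply/eigenvalueP; exists (row j P).
  rewrite BE -row_mul !mulmxA mulmxV // mul1mx row_mul.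
  by rewrite row_diag_mx aE -scalemxAl -rowE.
by apply: contraTneq P_unit => Pj0; rewrite unitmxE (expand_det_row _ j) big1 ?unitr0 // => l _;
 move/rowP/(_ l): Pj0; rewrite !mxE => ->; rewrite mul0r.
Qed.

(** * The entrywise scalar product of matrices *)

Section Frobenius.

Variables (R : realFieldType) (n : nat).
Implicit Types X Y Z A : 'M[R]_n.

(** The trace product of symmetric matrices in entrywise form, where signs and supports of entries
    can be exploited. *)
Definition frob X Y : R := \sum_u \sum_v X u v * Y u v.

Lemma frobC X Y : frob X Y = frob Y X.
Proof. by apply: eq_bigr => u _; apply: eq_bigr => v _; rewrite mulrC. Qed.

Lemma frobDl X Y Z : frob (X + Y) Z = frob X Z + frob Y Z.
Proof.
rewrite -big_split; apply: eq_bigr => u _; rewrite -big_split.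
by apply: eq_bigr => v _; rewrite mxE mulrDl.
Qed.

Lemma frobZl a X Y : frob (a *: X) Y = a * frob X Y.
Proof.
rewrite mulr_sumr; apply: eq_bigr => u _; rewrite mulr_sumr.
by apply: eq_bigr => v _; rewrite mxE mulrA.
Qed.

Lemma frob0l X : frob 0 X = 0.
Proof. by rewrite -[0](scale0r 0) frobZl mul0r. Qed.

Lemma frobBl X Y Z : frob (X - Y) Z = frob X Z - frob Y Z.
Proof. by rewrite frobDl -scaleN1r frobZl mulN1r. Qed.

Lemma frob_suml I (r : seq I) (F : I -> 'M[R]_n) X :
  frob (\sum_(i <- r) F i) X = \sum_(i <- r) frob (F i) X.
Proof. by elim/big_rec2: _ => [|i y Y _ <-]; rewrite ?frob0l ?frobDl. Qed.

Lemma frob_ge0 X : 0 <= frob X X.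
Proof.
by apply: sumr_ge0 => u _; apply: sumr_ge0 => v _; rewrite -expr2 sqr_ge0.
Qed.

Lemma frob_eq0 X : frob X X = 0 -> X = 0.
Proof.
have ge0 u v : 0 <= X u v * X u v by rewrite -expr2 sqr_ge0.
move=> X0; apply/matrixP => u v; rewrite mxE.
have Xu := psumr_eq0P (fun u _ => sumr_ge0 _ (fun v _ => ge0 u v)) X0 (isT : predT u).
have /(_ v)/eqP := psumr_eq0P (fun v _ => ge0 u v) (Xu u) (isT : predT v).
by rewrite mulf_eq0 orbb => /eqP.
Qed.

Lemma frob_mxtrace X Y : Y^T = Y -> \tr (X *m Y) = frob X Y.
Proof.
move=> Y_sym; apply: eq_bigr => u _; rewrite mxE; apply: eq_bigr => v _.
by rewrite -[in LHS]Y_sym mxE.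
Qed.

Lemma frob_mulmx_sym X Y A : A^T = A -> frob (X *m A) Y = frob X (Y *m A).
Proof.
move=> A_sym; apply: eq_bigr => u _.
under eq_bigr do rewrite mxE mulr_suml; rewrite exchange_big /=.
apply: eq_bigr => v _; rewrite mxE mulr_sumr; apply: eq_bigr => w _.
by rewrite -[in LHS]A_sym mxE; ring.
Qed.

End Frobenius.

Lemma trmx_horner_mx (R : comNzRingType) n (A : 'M[R]_n.+1) q :
  A^T = A -> (horner_mx A q)^T = horner_mx A q.
Proof.
move=> A_sym; elim/poly_ind: q => [|q c IH]; first by rewrite rmorph0 trmx0.
rewrite rmorphD rmorphM /= horner_mx_X horner_mx_C linearD /= tr_scalar_mx.
rewrite [_ * A]/(_ *m A) trmx_mul A_sym IH; congr (_ + _).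
by have := comm_horner_mx2 A 'X q; rewrite horner_mx_X.
Qed.

(** * Row sums, largest eigenvalue and harmonic rows for a regular graph *)

Section AdjacencyMatrix.

Variables (R : rcfType) (n : nat) (e : rel 'I_n.+1) (k : nat).
Hypotheses (e_sym : symmetric e) (e_conn : connected_graph e).
Hypothesis (e_reg : forall v, #|[set w | e v w]| = k).

Local Notation A := (adjmx R e).

Lemma trmx_adjmx : A^T = A.
Proof. by apply/matrixP => i j; rewrite !mxE e_sym. Qed.

Lemma mulmx_adjmxE (X : 'M[R]_n.+1) u v : (X *m A) u v = \sum_(w | e v w) X u w.
Proof.
rewrite mxE [RHS]big_mkcond /=; apply: eq_bigr => w _.
by rewrite mxE e_sym; case: (e v w); rewrite ?mulr1 ?mulr0.
Qed.

Lemma sum_neighbours_const v (a : R) : \sum_(w | e v w) a = k%:R * a.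
Proof.
by rewrite sumr_const -(e_reg v) cardsE mulr_natl.
Qed.

(** The all-ones vector is an eigenvector of [A] for [k], hence of each polynomial in [A]. *)
Lemma horner_adjmx_row_sum q u : \sum_v (horner_mx A q) u v = q.[k%:R].
Proof.
elim/poly_ind: q u => [|q c IH] u.
  by rewrite rmorph0 horner0 big1 // => v; rewrite mxE.
rewrite rmorphD rmorphM /= horner_mx_X horner_mx_C hornerMXaddC -(IH u) mulr_suml.
under eq_bigr do rewrite mxE [(_ * A) _ _]mulmx_adjmxE.
rewrite big_split /=; congr (_ + _); last first.
  rewrite (bigD1 u) //= big1 ?addr0 ?mxE ?eqxx ?mulr1n // => v.
  by rewrite mxE eq_sym => /negPf->.
under eq_bigr do rewrite big_mkcond /=; rewrite exchange_big /=.
apply: eq_bigr => w _; rewrite -big_mkcond /= mulrC -(sum_neighbours_const w).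
by apply: eq_bigl => v; rewrite e_sym.
Qed.

Lemma eigenvalue_degree : eigenvalue A k%:R.
Proof.
apply/eigenvalueP; exists (const_mx 1); last first.
  by apply/eqP => /rowP/(_ ord0)/eqP; rewrite !mxE oner_eq0.
apply/rowP => v; rewrite !mxE -(sum_neighbours_const v) [RHS]big_mkcond /=.
by apply: eq_bigr => w _; rewrite !mxE e_sym mul1r; case: e.
Qed.

(** Compare both sides of the eigenvector equation at a coordinate of largest absolute value. *)
Lemma eigenvalue_le_degree a : eigenvalue A a -> a <= k%:R.
Proof.
case/eigenvalueP=> x xA x0.
have [v _ vmax] := Order.TotalTheory.arg_maxP (fun v => `|x 0 v|) (erefl true : predT (ord0 : 'I_n.+1)).
have xv0 : 0 < `|x 0 v|.
  rewrite normr_gt0; apply: contra_neq x0 => xv0; apply/rowP => w; rewrite mxE.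
  by apply/eqP; rewrite -normr_le0; have := vmax w isT; rewrite xv0 normr0.
rewrite -(ler_pM2r xv0); apply: le_trans (_ : `|a * x 0 v| <= _).
  by rewrite normrM ler_wpM2r // ler_norm.
have -> : a * x 0 v = (x *m A) 0 v by rewrite xA mxE.
have -> : (x *m A) 0 v = \sum_(w | e v w) x 0 w.
  rewrite mxE [RHS]big_mkcond /=; apply: eq_bigr => w _.
  by rewrite mxE e_sym; case: e; rewrite ?mulr1 ?mulr0.
rewrite -(sum_neighbours_const v); apply: le_trans (ler_norm_sum _ _ _) _.
by apply: ler_sum => w _; apply: vmax.
Qed.

(* Maximum principle, propagated along paths from a maximal entry of the row. *)
Lemma harmonic_row_const (X : 'M[R]_n.+1) u :
  (forall v, \sum_(w | e v w) X u w = k%:R * X u v) -> forall v w, X u v = X u w.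
Proof.
move=> harm.
have [v _ vmax] := Order.TotalTheory.arg_maxP (X u) (erefl true : predT (ord0 : 'I_n.+1)).
suff const w : X u w = X u v by move=> x y; rewrite !const.
have /connectP[q vq ->] := e_conn v w.
elim/last_ind: q vq => [//|q x IH]; rewrite rcons_path last_rcons => /andP[/IH qv qx].
move: (harm (last v q)); rewrite qv -(sum_neighbours_const (last v q)) => /eqP.
rewrite -subr_eq0 -sumrB => /eqP /= s0.
apply/eqP; rewrite eq_sym -subr_eq0; apply/eqP.
apply: (psumr_eq0P (P := e (last v q)) (F := fun y => X u v - X u y)) qx => [y _|].
  by rewrite subr_ge0; apply: vmax.
by apply/eqP; rewrite -oppr_eq0 -sumrN -{2}s0; apply/eqP/eq_bigr => y _; rewrite opprB.
Qed.

End AdjacencyMatrix.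

(** * Predistance polynomials *)

Section Predistance.

Variables (R : rcfType) (n : nat) (e : rel 'I_n.+1) (k d : nat).
Variables (lam : 'I_d.+1 -> R) (p : nat -> {poly R}) (alpha beta gamma : nat -> R).
Hypotheses (e_sym : symmetric e) (e_conn : connected_graph e).
Hypothesis e_reg : forall v, #|[set w | e v w]| = k.
Hypothesis lam_spec : distinct_spectrum e lam.
Hypothesis p_predist : predistance_polynomials e lam p.
Hypothesis preint : preintersection_numbers lam p alpha beta gamma.

Implicit Types q r : {poly R}.
Local Notation A := (adjmx R e).
Local Notation P i := (horner_mx A (p i)).
Local Notation s i := (p i).[lam ord0].
Local Notation N := (n.+1%:R : R).

Lemma lam_inj : injective lam.
Proof.
case: lam_spec => dec _ i j ij; apply: val_inj.
by case: (ltngtP i j) => // /dec; rewrite ij ltxx.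
Qed.

Lemma lam0E : lam ord0 = k%:R.
Proof.
case: (lam_spec) => dec eig; apply/eqP; rewrite eq_le.
rewrite (eigenvalue_le_degree e_sym e_reg); last by apply/eig; exists ord0.
have [i <-] := (eig _).1 (eigenvalue_degree R e_sym e_reg).
have [->|i0] := eqVneq i ord0; [by rewrite lexx|apply/ltW/dec].
by rewrite lt0n; apply: contra_neq i0 => i0; apply: val_inj.
Qed.

(** Transfers identities between functions on the spectrum and polynomials in [A]: eigenvalues are
    roots of the minimal polynomial, and [A] is diagonalizable. *)
Lemma horner_adjmx_eq0 q : horner_mx A q = 0 <-> forall j, q.[lam j] = 0.
Proof.
split=> [qA j|q0].
  have /mxminpoly_minP/dvdpP[r ->] := qA.
  rewrite hornerM (rootP (_ : root (mxminpoly A) (lam j))) ?mulr0 //.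
  by rewrite -eigenvalue_root_min; apply/(lam_spec.2 _); exists j.
apply: symmetric_horner_mx_eq0; first exact: trmx_adjmx.
by move=> a /(lam_spec.2 _)[j <-]; apply/rootP.
Qed.

Lemma poly_eq0_on_spectrum q : (size q <= d.+1)%N -> (forall j, q.[lam j] = 0) -> q = 0.
Proof.
move=> sq q0; apply/eqP; apply: contraTT sq => nz; rewrite -ltnNge.
rewrite -[X in (X < _)%N]card_ord -(size_codom lam); apply: max_poly_roots nz _ _.
  by apply/allP => _ /codomP[j ->]; apply/rootP.
by rewrite map_inj_uniq ?enum_uniq //; apply: lam_inj.
Qed.

Lemma gprod_frob q r : N * gprod e q r = frob (horner_mx A q) (horner_mx A r).
Proof.
rewrite /gprod mulrA mulfV ?pnatr_eq0 // mul1r frob_mxtrace //.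
by apply/trmx_horner_mx/trmx_adjmx.
Qed.

Lemma frob_predist i : (i <= d)%N -> frob (P i) (P i) = N * s i.
Proof. by move=> id; rewrite -gprod_frob; case: p_predist => _ _ ->. Qed.

Lemma frob_predist0 i j : (i <= d)%N -> (j <= d)%N -> i <> j ->
  frob (P i) (P j) = 0.
Proof.
by move=> id jd ij; rewrite -gprod_frob; case: p_predist => _ -> //; rewrite mulr0.
Qed.

(** This value is a squared norm, and a polynomial of degree [i <= d] cannot vanish at all [d.+1]
    eigenvalues. *)
Lemma predist_gt0 i : (i <= d)%N -> 0 < s i.
Proof.
move=> id; rewrite -(pmulr_rgt0 _ (ltr0Sn R n)) -frob_predist // lt_def frob_ge0 andbT.
apply/eqP => /frob_eq0/horner_adjmx_eq0 pi0.
have size_pi : size (p i) = i.+1 by case: p_predist => ->.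
have pi_eq0 : p i = 0 by apply: poly_eq0_on_spectrum; rewrite ?size_pi.
by move: size_pi; rewrite pi_eq0 size_poly0.
Qed.

Lemma predist_neq0 i : (i <= d)%N -> N * s i != 0.
Proof. by move=> /predist_gt0 si; rewrite mulf_neq0 ?pnatr_eq0 // gt_eqF. Qed.

Lemma recurrence_mx i : (i <= d)%N ->
  P i *m A = (if i is i'.+1 then beta i' *: P i' else 0) + alpha i *: P i
             + (if (i < d)%N then gamma i.+1 *: P i.+1 else 0).
Proof.
move=> id; pose q := (if i is i'.+1 then beta i' *: p i' else 0) + alpha i *: p i
             + (if (i < d)%N then gamma i.+1 *: p i.+1 else 0).
have -> : P i *m A = horner_mx A (p i * 'X) by rewrite rmorphM /= horner_mx_X.
transitivity (horner_mx A q); last first.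
  rewrite !rmorphD /= linearZ /=; congr (_ + _ + _); last first.
    by case: ifP; rewrite ?rmorph0 ?linearZ.
  by case: (i); rewrite ?rmorph0 //= => j; rewrite linearZ.
apply/eqP; rewrite -subr_eq0 -rmorphB; apply/eqP/horner_adjmx_eq0 => j.
case: preint => _ _ /(_ i j id) rec.
rewrite hornerD hornerN hornerMX mulrC rec !hornerD hornerZ.
apply/eqP; rewrite subr_eq0; apply/eqP; congr (_ + _ + _).
  by case: (i) => [|i']; rewrite ?horner0 ?hornerZ.
by case: ifP; rewrite ?horner0 ?hornerZ.
Qed.

(** By orthogonality, pairing the recurrence with a single [P j] isolates one coefficient; the next
    two lemmas do the same for [alpha] and [gamma]. *)
Lemma frob_recurrence_l i : (i < d)%N ->
  frob (P i.+1 *m A) (P i) = beta i * (N * s i).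
Proof.
move=> id; rewrite recurrence_mx // !frobDl !frobZl (frob_predist (ltnW id)).
rewrite (@frob_predist0 i.+1 i) ?mulr0 ?addr0 //; [|by lia..].
case: ifP => id'; last by rewrite frob0l addr0.
by rewrite frobZl (@frob_predist0 i.+2 i) ?mulr0 ?addr0 //; lia.
Qed.

Lemma frob_recurrence_m i : (i <= d)%N -> frob (P i *m A) (P i) = alpha i * (N * s i).
Proof.
move=> id; rewrite recurrence_mx // !frobDl frobZl frob_predist //.
case: ifP => id'; rewrite ?frob0l ?frobZl ?(@frob_predist0 i.+1 i) ?mulr0 ?addr0 //;
  try by lia.
  case: i id {id'} => [|i] id; rewrite ?frob0l ?add0r // frobZl.
  by rewrite frob_predist0 ?mulr0 ?add0r //; lia.
case: i id {id'} => [|i] id; rewrite ?frob0l ?add0r // frobZl.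
by rewrite frob_predist0 ?mulr0 ?add0r //; lia.
Qed.

Lemma frob_recurrence_r i : (i < d)%N ->
  frob (P i *m A) (P i.+1) = gamma i.+1 * (N * s i.+1).
Proof.
move=> id; rewrite (recurrence_mx (ltnW id)) !frobDl id !frobZl frob_predist //.
rewrite (@frob_predist0 i i.+1) ?mulr0 ?addr0 //; [|by lia..].
case: i id => [|i] id; rewrite ?frob0l ?add0r // frobZl.
by rewrite frob_predist0 ?mulr0 ?add0r //; lia.
Qed.

(** Multiplication by the symmetric matrix [A] is self-adjoint for [frob]. *)
Lemma beta_gamma i : (i < d)%N -> beta i * s i = gamma i.+1 * s i.+1.
Proof.
move=> id; apply: (mulfI (_ : N != 0)); first by rewrite pnatr_eq0.
rewrite mulrCA -frob_recurrence_l // mulrCA -frob_recurrence_r //.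
by rewrite (frob_mulmx_sym _ _ (trmx_adjmx R e_sym)) frobC.
Qed.

(** Otherwise [p i * 'X - q], of degree [i.+1 <= d], would vanish at all [d.+1] eigenvalues. *)
Lemma gamma_neq0 i : (i < d)%N -> gamma i.+1 != 0.
Proof.
move=> id; apply/eqP => g0.
have size_p j : (j <= d)%N -> size (p j) = j.+1 by case: p_predist => + _ _; apply.
pose q := (if i is i'.+1 then beta i' *: p i' else 0) + alpha i *: p i.
have sq : (size q <= i.+1)%N.
  rewrite (leq_trans (size_polyD _ _)) // geq_max (leq_trans (size_scale_leq _ _)).
    case: (i) (id) => [|j] jd; rewrite ?size_poly0 //.
    by rewrite (leq_trans (size_scale_leq _ _)) // size_p //; lia.
  by rewrite size_p // ltnW.
have sX : size (p i * 'X) = i.+2.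
  by rewrite size_mulX ?size_p 1?ltnW // -size_poly_eq0 size_p // ltnW.
have : p i * 'X - q = 0.
  apply: poly_eq0_on_spectrum.
    rewrite (leq_trans (size_polyD _ _)) // size_polyN geq_max sX ltnS id /=.
    by apply: leq_trans sq _; lia.
  move=> j; case: preint => _ _ /(_ i j (ltnW id)) rec.
  rewrite hornerD hornerN hornerMX mulrC rec hornerD hornerZ id g0 mul0r addr0.
  apply/eqP; rewrite subr_eq0; apply/eqP; congr (_ + _).
  by case: (i) => [|i']; rewrite ?horner0 ?hornerZ.
by move/eqP; rewrite subr_eq0 => /eqP qE; move: sq; rewrite -qE sX; lia.
Qed.

(** At [lam ord0], [beta_gamma] rewrites the [beta] term of the last recurrence as [gamma d * s d],
    and the positive factor [s d] cancels. *)
Lemma alpha_gamma_last : (0 < d)%N -> alpha d + gamma d = lam ord0.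
Proof.
move=> d_gt0; have bg m : (0 < m <= d)%N ->
    (if m is i.+1 then beta i * s i else 0) = gamma m * s m.
  by case: m => [//|i] /= id; apply: beta_gamma.
case: preint => _ _ /(_ d ord0 (leqnn d)); rewrite ltnn addr0 bg ?d_gt0 ?leqnn //.
rewrite -mulrDl addrC => /(mulIf _) -> //.
by rewrite gt_eqF // predist_gt0.
Qed.

(** * The basis of predistance polynomials and the trace identity *)

Let V : 'M[R]_d.+1 := \matrix_(i, j) (p i).[lam j].

(** A linear relation between the rows is one between the matrices [P i], which are orthogonal and
    nonzero. *)
Lemma predist_values_unit : V \in unitmx.
Proof.
rewrite -row_free_unit; apply: inj_row_free => u uV.
have : \sum_i u 0 i *: P i = 0.
  transitivity (horner_mx A (\sum_i u 0 i *: p i)).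
    by rewrite rmorph_sum /=; apply: eq_bigr => i _; rewrite linearZ.
  apply/horner_adjmx_eq0 => j; rewrite horner_sum.
  have /rowP/(_ j) := uV; rewrite !mxE => uVj; rewrite -[RHS]uVj.
  by apply: eq_bigr => i _; rewrite hornerZ [V _ _]mxE.
move=> uP; apply/rowP => i; rewrite mxE.
have := congr1 (fun X => frob X (P i)) uP; rewrite frob0l frob_suml (bigD1 i) //=.
rewrite frobZl frob_predist -1?ltnS // big1 => [|j ji].
  move/eqP; rewrite addr0 mulf_eq0 (negPf (predist_neq0 _)) -1?ltnS //.
  by rewrite orbF => /eqP.
by rewrite frobZl frob_predist0 ?mulr0 -1?ltnS // => /ord_inj; apply/eqP.
Qed.

Lemma horner_adjmx_span q : exists u : 'rV_d.+1, horner_mx A q = \sum_i u 0 i *: P i.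
Proof.
exists ((\row_j q.[lam j]) *m invmx V); set u := _ *m _.
apply/eqP; rewrite -subr_eq0; apply/eqP.
transitivity (horner_mx A (q - \sum_i u 0 i *: p i)).
  rewrite rmorphB rmorph_sum /=; congr (_ - _).
  by apply: eq_bigr => i _; rewrite linearZ.
apply/horner_adjmx_eq0 => j; rewrite hornerD hornerN horner_sum.
have /rowP/(_ j) : u *m V = \row_j q.[lam j] by rewrite mulmxKV // predist_values_unit.
rewrite !mxE => <-; apply/eqP; rewrite subr_eq0; apply/eqP.
by apply: eq_bigr => i _; rewrite hornerZ [V _ _]mxE.
Qed.

(* Both sides are the trace of multiplication by [x] modulo the minimal polynomial of [A]. *)
Lemma sum_alpha : \sum_(i < d.+1) alpha i = \sum_(i < d.+1) lam i.
Proof.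
(* [T] is the tridiagonal matrix whose rows hold the recurrence coefficients; [V] conjugates it to
   the diagonal matrix of the eigenvalues. *)
pose T : 'M[R]_d.+1 := \matrix_(i, j) ((if i == j.+1 :> nat then beta j else 0)
  + (if i == j then alpha i else 0) + (if j == i.+1 :> nat then gamma j else 0)).
have TV : T *m V = V *m diag_mx (\row_j lam j).
  apply/matrixP => i j; rewrite mul_mx_diag !mxE mulrC.
  case: preint => _ _ ->; last by rewrite -ltnS.
  under eq_bigr do rewrite !mxE !mulrDl.
  rewrite !big_split /=; congr (_ + _ + _).
  - case: i => [[|i] ilt] /=; first by rewrite big1 // => l _; rewrite mul0r.
    rewrite (bigD1 (Ordinal (ltnW ilt))) //= eqxx big1 ?addr0 // => l li.
    by rewrite eqSS eq_sym ifN ?mul0r.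
  - rewrite (bigD1 i) //= eqxx big1 ?addr0 // => l li.
    by rewrite eq_sym (negPf li) mul0r.
  - case: ifP => id.
      have id' : (i.+1 < d.+1)%N by [].
      rewrite (bigD1 (Ordinal id')) //= eqxx big1 ?addr0 // => l li.
      by rewrite ifN ?mul0r.
    rewrite big1 // => l _; rewrite ifN ?mul0r //; apply: contraFneq id => li.
    by rewrite -ltnS -li.
have TE : T = V *m diag_mx (\row_j lam j) *m invmx V.
  by rewrite -TV mulmxK // predist_values_unit.
transitivity (\tr T).
  apply: eq_bigr => i _; rewrite mxE eqxx ltn_eqF //.
  by rewrite add0r addr0.
rewrite TE mxtrace_mulC mulmxA mulVmx ?predist_values_unit // mul1mx mxtrace_diag.
by apply: eq_bigr => i _; rewrite mxE.
Qed.

(** * The Hoffman polynomial *)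

Lemma predist_row_sum i u : \sum_v P i u v = s i.
Proof. by rewrite (horner_adjmx_row_sum e_sym e_reg) lam0E. Qed.

(** The product [h] vanishes at every eigenvalue but the largest, so the rows of [h(A)] are
    harmonic, hence constant; by symmetry the matrix is constant, and it is nonzero since [h] is
    nonzero at [lam ord0]. *)
Lemma all_ones_horner : exists q, horner_mx A q = const_mx 1.
Proof.
pose h := \prod_(j < d.+1 | j != ord0) ('X - (lam j)%:P).
have harm : horner_mx A h *m A = lam ord0 *: horner_mx A h.
  apply/eqP; rewrite -subr_eq0; apply/eqP.
  transitivity (horner_mx A (h * ('X - (lam ord0)%:P))).
    rewrite rmorphM rmorphB /= horner_mx_X horner_mx_C.
    by rewrite -mulmxE mulmxBr mul_mx_scalar.
  apply/horner_adjmx_eq0 => j; rewrite hornerM !hornerE.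
  have [->|j0] := eqVneq j ord0; first by rewrite subrr mulr0.
  by rewrite /h horner_prod (bigD1 j) //= !hornerE subrr !mul0r.
set H := horner_mx A h in harm *.
have Hsym : H^T = H by apply/trmx_horner_mx/trmx_adjmx.
have Hrow u v w : H u v = H u w.
  apply: (harmonic_row_const e_conn e_reg) => x; rewrite -(mulmx_adjmxE e_sym).
  by rewrite harm mxE lam0E.
have Hconst u v : H u v = H ord0 ord0.
  by rewrite (Hrow u v ord0) -[in LHS]Hsym mxE; apply: Hrow.
have H0 : H ord0 ord0 != 0.
  apply/eqP => H00; have : H = 0 by apply/matrixP => u v; rewrite Hconst H00 mxE.
  move/horner_adjmx_eq0/(_ ord0)/eqP; rewrite /h horner_prod.
  case/prodf_eq0=> j j0; rewrite !hornerE subr_eq0 => /eqP/lam_inj j0'.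
  by rewrite -j0' eqxx in j0.
exists ((H ord0 ord0)^-1 *: h); rewrite linearZ /= -/H.
by apply/matrixP => u v; rewrite mxE (Hconst u v) mulVf // mxE.
Qed.

(** The all-ones matrix and the sum have the same product [N * s i] with each [P i], so their
    difference is orthogonal to the span in which it lies. *)
Lemma sum_predist : \sum_(i < d.+1) P i = const_mx 1.
Proof.
have [q qJ] := all_ones_horner; have [u uE] := horner_adjmx_span q.
rewrite -qJ; apply/eqP; rewrite eq_sym -subr_eq0; apply/eqP.
have ortho i : (i <= d)%N -> frob (horner_mx A q - \sum_(j < d.+1) P j) (P i) = 0.
  move=> id; rewrite frobBl frob_suml (bigD1 (inord i)) //= inordK // big1 => [|j ji].
    rewrite addr0 frob_predist // qJ /frob.
    under eq_bigr => w _ do under eq_bigr do rewrite mxE mul1r.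
    under eq_bigr do rewrite predist_row_sum.
    by rewrite sumr_const card_ord mulr_natl subrr.
  rewrite frob_predist0 -1?ltnS // => jE; case/eqP: ji; apply: val_inj.
  by rewrite /= inordK.
set D := _ - _ in ortho *.
apply: frob_eq0; rewrite {1}/D frobBl uE !frob_suml !big1 ?subr0 // => i _.
  by rewrite frobC ortho // -ltnS.
by rewrite frobZl frobC ortho ?mulr0 // -ltnS.
Qed.

End Predistance.

(** * Predistance polynomials and distance matrices *)

Lemma sum_delta (R : pzSemiRingType) m g : \sum_(0 <= i < m) (g == i)%:R = (g < m)%:R :> R.
Proof.
elim: m => [|m IH]; first by rewrite big_geq.
by rewrite big_nat_recr //= IH ltnS; case: ltngtP; rewrite ?addr0 ?add0r.
Qed.

Section PredistanceDistance.

Variables (R : rcfType) (n : nat) (e : rel 'I_n.+1) (k d : nat).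
Variables (lam : 'I_d.+1 -> R) (p : nat -> {poly R}) (alpha beta gamma : nat -> R).
Hypotheses (e_sym : symmetric e) (e_irr : irreflexive e) (e_conn : connected_graph e).
Hypothesis e_reg : forall v, #|[set w | e v w]| = k.
Hypothesis lam_spec : distinct_spectrum e lam.
Hypothesis p_predist : predistance_polynomials e lam p.
Hypothesis preint : preintersection_numbers lam p alpha beta gamma.

Local Notation A := (adjmx R e).
Local Notation P i := (horner_mx A (p i)).
Local Notation s i := (p i).[lam ord0].
Local Notation N := (n.+1%:R : R).

Definition distmx i : 'M[R]_n.+1 := \matrix_(u, v) (gdist e u v == i)%:R.

Lemma mulmx_distmx_adjmx i u v : (distmx i *m A) u v = (sphere_num e u v i)%:R.
Proof.
rewrite mulmx_adjmxE // /sphere_num -sum1dep_card natr_sum [RHS]big_mkcondr /=.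
by apply: eq_bigr => w _; rewrite mxE; case: eqP.
Qed.

(** The constant [c = p 0] is nonzero and satisfies [c * c = c] by the normalization. *)
Lemma predist0_distmx : P 0 = distmx 0.
Proof.
have [c pE] : exists c, p 0 = c%:P.
  case: (p_predist) => /(_ 0%N isT) /eqP/size_poly1P[c _ ->] _ _.
  by exists c.
have dist0 : distmx 0 = 1%:M.
  by apply/matrixP => u v; rewrite !mxE gdist_eq0.
have := frob_predist e_sym p_predist (leq0n d); have := predist_neq0 e_sym lam_spec p_predist (leq0n d).
rewrite dist0 pE hornerC horner_mx_C mulf_eq0 negb_or => /andP[_ c0].
rewrite -(scalemx1 _ c) frobZl frobC frobZl mulrA => cE.
suff -> : c = 1 by rewrite scale1r.
apply: (mulIf c0); rewrite mul1r; apply: (mulIf (_ : N != 0)); first by rewrite pnatr_eq0.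
rewrite [RHS]mulrC -cE; congr (_ * _); apply/esym; rewrite /frob.
transitivity (\sum_(u < n.+1) (1 : R)); last by rewrite sumr_const card_ord.
apply: eq_bigr => u _; rewrite (bigD1 u) //= big1 => [|v vu].
  by rewrite mxE eqxx mulr1 addr0.
by rewrite mxE eq_sym (negPf vu) mul0r.
Qed.

(** Of the [k] neighbours of [v] none is at distance [i], and [0 < i] is the number of those nearer
    to [u]. *)
Lemma sphere_num_inner i u v : gdist e u v = i -> ~~ flat_edge e i ->
  ((0 < i)%N -> c_num e u v = 1%N) -> sphere_num e u v i.+1 = (k - (0 < i))%N.
Proof.
move=> duv noflat c1; rewrite -(b_numE duv) -(e_reg v) (card_neighbours e_sym e_conn u v).
rewrite flat_edgeN_a_num ?duv //; case: posnP c1 => [i0 _|i0 ->] //.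
  by rewrite (c_num0 (etrans duv i0)) subn0.
by lia.
Qed.

(** Read the recurrence entrywise: without flat edges nothing remains at distance [i], the [beta]
    term cancels the contribution at distance [i - 1], and only distance [i.+1] survives. *)
Lemma predist_step i : (i < d)%N -> (forall j, (j <= i)%N -> P j = distmx j) ->
  (forall j, (j <= i)%N -> ~~ flat_edge e j) ->
  (forall u v, (0 < gdist e u v)%N -> (gdist e u v < i)%N -> c_num e u v = 1%N) ->
  alpha i = 0 /\ forall u v, gamma i.+1 * P i.+1 u v =
    if gdist e u v == i.+1 then (c_num e u v)%:R else 0.
Proof.
move=> id PD noflat c1.
have sphere_flat u v : gdist e u v = i -> sphere_num e u v i = 0%N.
  by move=> duv; rewrite -(a_numE duv) flat_edgeN_a_num // duv noflat.
have alpha0 : alpha i = 0.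
  apply: (mulIf (predist_neq0 e_sym lam_spec p_predist (ltnW id))).
  rewrite mul0r -(frob_recurrence_m e_sym lam_spec p_predist preint (ltnW id)).
  rewrite PD // /frob big1 // => u _; rewrite big1 // => v _.
  rewrite mulmx_distmx_adjmx mxE; case: eqP => [duv|]; last by rewrite mulr0.
  by rewrite sphere_flat // mul0r.
have sphere_in u v j : i = j.+1 -> gdist e u v = j ->
    sphere_num e u v j.+1 = (k - (0 < j))%N.
  move=> ij duv; apply: sphere_num_inner => //; first by apply: noflat; lia.
  by move=> j0; apply: c1; rewrite duv // ij.
(* Pairing with [P j] exhibits [beta j] as an average of outward counts, all equal to
   [k - (0 < j)]. *)
have betaE j : i = j.+1 -> beta j = (k - (0 < j))%:R.
  move=> ij; have jd : (j < d)%N by lia.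
  apply: (mulIf (predist_neq0 e_sym lam_spec p_predist (ltnW jd))).
  rewrite -(frob_recurrence_l e_sym lam_spec p_predist preint jd).
  rewrite -(frob_predist e_sym p_predist (ltnW jd)) !PD; [|by lia..].
  rewrite /frob mulr_sumr; apply: eq_bigr => u _; rewrite mulr_sumr.
  apply: eq_bigr => v _; rewrite mulmx_distmx_adjmx !mxE.
  by case: eqP => [duv|]; rewrite ?mulr0 // (sphere_in _ _ _ ij duv) mul1r.
split=> // u v; have := recurrence_mx e_sym lam_spec preint (ltnW id).
rewrite alpha0 scale0r addr0 id PD // => /matrixP/(_ u v).
rewrite mulmx_distmx_adjmx mxE [X in _ = _ + X]mxE => E.
have {E} -> : gamma i.+1 * P i.+1 u v = (sphere_num e u v i)%:R -
    (if i is i'.+1 then beta i' *: P i' else 0) u v by rewrite E addrC addKr.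
have -> : (if i is i'.+1 then beta i' *: P i' else 0) u v =
    (if i is i'.+1 then (if gdist e u v == i' then (sphere_num e u v i)%:R else 0) else 0).
  case: (i) betaE PD sphere_in => [|j] betaE PD sphere_in; first by rewrite mxE.
  rewrite mxE (betaE j) // PD ?leqnSn // mxE.
  by case: eqP => [duv|]; rewrite ?mulr0 // (sphere_in _ _ j) // mulr1.
case: eqP => [duv|/eqP dni1].
  rewrite (c_numE duv); case: (i) duv => [|j] duv; first by rewrite subr0.
  by rewrite ifN ?subr0 // duv; lia.
case: (eqVneq (gdist e u v) i) => [duv|dni].
  rewrite sphere_flat //; case: (i) => [|j]; first by rewrite subr0.
  by case: ifP; rewrite subr0.
have far j : i = j.+1 -> gdist e u v != j -> sphere_num e u v i = 0%N.
  by move=> ij duv; apply: sphere_num_far => //; lia.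
case: (i) dni1 dni far => [|j] dni1 dni far.
  by rewrite sphere_num_far ?subr0 //; lia.
by case: eqP => [|/eqP dj]; rewrite ?subrr // (far j) // subr0.
Qed.

Hypothesis no_flat : forall i, (i.+2 <= d)%N -> ~~ flat_edge e i.
Hypothesis c_num1 : forall u v, (0 < gdist e u v)%N -> ((gdist e u v).+2 <= d)%N ->
  c_num e u v = 1%N.

Lemma predist_distmx_small i : (i.+2 <= d)%N -> P i = distmx i.
Proof.
elim/ltn_ind: i => -[|i] IH id; first exact: predist0_distmx.
have [|j ji|j ji|u v u0 ui|_ step] := @predist_step i; first by lia.
- by apply: IH; lia.
- by apply: no_flat; lia.
- by apply: c_num1 => //; lia.
have gP : gamma i.+1 *: P i.+1 = distmx i.+1.
  apply/matrixP => u v; rewrite mxE step [RHS]mxE; case: eqP => // duv.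
  by rewrite c_num1 ?duv //; lia.
have gi : gamma i.+1 != 0 by apply: (gamma_neq0 lam_spec p_predist preint); lia.
have i1d : (i.+1 <= d)%N by lia.
suff g1 : gamma i.+1 = 1 by rewrite -gP g1 scale1r.
(* For a 0/1 matrix the squared norm is the sum of the entries; comparing this with
   [gamma i.+1 ^ 2 * (N * s i.+1)] forces [gamma i.+1 = 1]. *)
have Dsum : frob (distmx i.+1) (distmx i.+1) = N * (gamma i.+1 * s i.+1).
  transitivity (\sum_(u < n.+1) gamma i.+1 * s i.+1); last first.
    by rewrite sumr_const card_ord mulr_natl.
  apply: eq_bigr => u _.
  rewrite -(predist_row_sum p e_sym e_reg lam_spec i.+1 u) mulr_sumr.
  apply: eq_bigr => v _; have /matrixP/(_ u v) := gP; rewrite mxE => ->.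
  by rewrite mxE; case: eqP; rewrite ?mulr0 ?mulr1.
move: Dsum; rewrite -gP frobZl frobC frobZl (frob_predist e_sym p_predist i1d).
rewrite [RHS]mulrCA => /(mulfI gi) g1.
by apply: (mulIf (predist_neq0 e_sym lam_spec p_predist i1d)); rewrite mul1r.
Qed.

(* When [d = 1] the constant [t] is [1], since [c_num] vanishes at distance [0]. *)
Lemma predist_penultimate d' : d = d'.+1 -> exists t : nat -> R,
  (forall u v, P d' u v = if gdist e u v == d' then t (c_num e u v) else 0) /\
  (forall u v u' v', gdist e u v = d' -> gdist e u' v' = d' ->
     0 < t (c_num e u v) * t (c_num e u' v')).
Proof.
case: d' => [|d'] dE.
  exists (fun=> 1); split=> *; rewrite ?mulr1 // predist0_distmx mxE.
  by case: eqP.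
have [|j ji|j ji|u v u0 ui|_ step] := @predist_step d'; first by lia.
- by apply: predist_distmx_small; lia.
- by apply: no_flat; lia.
- by apply: c_num1 => //; lia.
have g0 : gamma d'.+1 != 0 by apply: (gamma_neq0 lam_spec p_predist preint); lia.
(* A product of two values of [t] carries the square of the inverse of [gamma d'.+1], hence is
   positive whatever its sign. *)
exists (fun c => (gamma d'.+1)^-1 * c%:R); split=> [u v|u v u' v' duv duv'].
  apply: (mulfI g0); rewrite step; case: eqP => _; last by rewrite mulr0.
  by rewrite mulVKf.
rewrite mulrACA; apply: mulr_gt0.
  by rewrite -expr2 exprn_even_gt0 //= invr_eq0.
by apply: mulr_gt0; rewrite ltr0n; apply: c_num_gt0 => //; [apply: duv|apply: duv'].
Qed.

(** Up to a positive factor, [alpha d'] is a sum over edges [v w] and vertices [u] of the products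
    [P d' u w * P d' u v], which are positive on flat edges at distance [d'] and zero elsewhere. *)
Lemma penultimate_alpha d' : d = d'.+1 ->
  0 <= alpha d' /\ (alpha d' = 0 <-> ~~ flat_edge e d').
Proof.
move=> dE; have [t [PE tpos]] := predist_penultimate dE.
have d'd : (d' <= d)%N by lia.
have sN : 0 < N * s d' by rewrite mulr_gt0 ?ltr0Sn ?(predist_gt0 e_sym lam_spec p_predist).
pose term u v := (P d' *m A) u v * P d' u v.
have termE u v : term u v = \sum_(w | e v w) P d' u w * P d' u v.
  by rewrite /term mulmx_adjmxE // mulr_suml.
have ww0 u v w : 0 <= P d' u w * P d' u v.
  rewrite !PE; case: eqP => [dw|_]; last by rewrite mul0r.
  by case: eqP => [dv|_]; [rewrite ltW // tpos|rewrite mulr0].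
have term0 u v : 0 <= term u v by rewrite termE sumr_ge0.
have alphaE : alpha d' * (N * s d') = \sum_u \sum_v term u v.
  by rewrite -(frob_recurrence_m e_sym lam_spec p_predist preint d'd).
split.
  rewrite -(pmulr_lge0 _ sN) alphaE.
  by apply: sumr_ge0 => u _; apply: sumr_ge0.
split=> [a0|noflat].
  apply/negP => /flat_edgeP[u [v [w [vw dv dw]]]].
  move: alphaE; rewrite a0 mul0r => /esym/eqP; apply/negP.
  rewrite gt_eqF // (bigD1 u) //= ltr_pwDl //; last first.
    by apply: sumr_ge0 => x _; apply: sumr_ge0.
  rewrite (bigD1 v) //= ltr_pwDl //; last by apply: sumr_ge0.
  rewrite termE (bigD1 w) //= ltr_pwDl //; last by apply: sumr_ge0.
  by rewrite !PE dv dw eqxx tpos.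
apply: (mulIf (lt0r_neq0 sN)); rewrite alphaE mul0r.
rewrite big1 // => u _; rewrite big1 // => v _; rewrite termE big1 // => w vw.
rewrite !PE; case: eqP => [dw|_]; last by rewrite mul0r.
case: eqP => [dv|_]; last by rewrite mulr0.
by case/negP: noflat; apply/flat_edgeP; exists u, v, w.
Qed.

(** Only [alpha d'] and [alpha d] survive in the trace identity, and [alpha_gamma_last] eliminates
    the latter. *)
Lemma gamma_last d' : d = d'.+1 ->
  gamma d = alpha d' - \sum_(i < d.+1 | i != ord0) lam i.
Proof.
move=> dE; have d_gt0 : (0 < d)%N by lia.
have := sum_alpha e_sym lam_spec p_predist preint.
rewrite [X in _ = X](bigD1 ord0) //=.
rewrite -(alpha_gamma_last e_sym lam_spec p_predist preint d_gt0).
rewrite big_ord_recr /=.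
have -> : \sum_(i < d) alpha i = alpha d'.
  have d'd : (d' < d)%N by lia.
  rewrite (bigD1 (Ordinal d'd)) //= big1 ?addr0 // => i id'.
  have id2 : (i.+2 <= d)%N.
    have := ltn_ord i; suff : i != d' :> nat by lia.
    by apply: contra_neq id' => id'; apply: val_inj.
  have [||j ji|u v u0 ui|//] := @predist_step i; first exact: ltn_ord.
  - by move=> j ji; apply: predist_distmx_small; lia.
  - by apply: no_flat; lia.
  - by apply: c_num1 => //; lia.
by move=> E; lra.
Qed.

Lemma sum_predist_entry d' u v : d = d'.+1 ->
  (gdist e u v < d')%:R + P d' u v + P d u v = 1.
Proof.
move=> dE; have /matrixP/(_ u v) := sum_predist e_sym e_conn e_reg lam_spec p_predist.
rewrite summxE [RHS]mxE -(big_mkord predT (fun i => P i u v)).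
rewrite {1}dE !big_nat_recr //= -dE => one; rewrite -[RHS]one; congr (_ + _ + _).
rewrite -sum_delta; apply: eq_big_nat => i /= id.
by rewrite predist_distmx_small ?mxE //; lia.
Qed.

Lemma predist_distmx d' : d = d'.+1 -> ~~ flat_edge e d' ->
  forall i, (i <= d)%N -> P i = distmx i.
Proof.
move=> dE noflat; have [t [PE tpos]] := predist_penultimate dE.
have alpha0 : alpha d' = 0 by apply/(penultimate_alpha dE).2.
have d'd : (d' < d)%N by lia.
have gd : gamma d'.+1 != 0 by apply: (gamma_neq0 lam_spec p_predist preint).
have J u v := sum_predist_entry u v dE.
(* The recurrence for [d'] gives [gamma d * P d u v] from the entries of [P d'] at the neighbours of
   [v]; its [beta] term is supported at distance [d' - 1]. *)
have Pd0 u v : (d' <= gdist e u v)%N ->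
    (forall w, e v w -> gdist e u w <> d') -> P d u v = 0.
  move=> duv nb; apply: (mulfI gd); rewrite mulr0.
  have := recurrence_mx e_sym lam_spec preint (ltnW d'd).
  rewrite d'd alpha0 scale0r addr0 -dE => /matrixP/(_ u v).
  rewrite mulmx_adjmxE // mxE [X in _ = _ + X]mxE => E.
  have {E} -> : gamma d * P d u v = \sum_(w | e v w) P d' u w -
      (if d' is i'.+1 then beta i' *: P i' else 0) u v by rewrite E addrC addKr.
  rewrite big1 => [|w /nb/eqP/negPf dw]; last by rewrite PE dw.
  case: (d') duv dE => [|j] duv dE'; first by rewrite mxE subr0.
  rewrite mxE predist_distmx_small ?mxE; last by lia.
  by rewrite gtn_eqF // mulr0 subr0.
(* At distance [d'] the absence of flat edges makes the entry of [P d] vanish, so the Hoffman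
   identity leaves 1 for [P d']. *)
have Pd' u v : P d' u v = (gdist e u v == d')%:R.
  case: eqP => [duv|/eqP/negPf dn]; last by rewrite PE dn.
  have := J u v; rewrite duv ltnn add0r Pd0 ?addr0 // ?duv // => w vw dw.
  by case/negP: noflat; apply/flat_edgeP; exists u, v, w.
move=> i id; have [id2|] := boolP (i.+2 <= d)%N; first exact: predist_distmx_small.
move=> id2; have [ {id2}->|ind'] := eqVneq i d'; apply/matrixP => u v; rewrite [RHS]mxE //.
have -> : i = d by lia.
have := J u v; rewrite Pd'; case: (ltngtP (gdist e u v) d') => duv.
- rewrite addr0 -[RHS]addr0 => /addrI ->; rewrite ltn_eqF //; lia.
(* Beyond distance [d'] the Hoffman identity gives 1, while [Pd0] gives 0 beyond distance [d]; so no
   pair is farther apart than [d]. *)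
- rewrite !add0r => Pd1; rewrite Pd1; case: eqP => // /eqP dn.
  move/eqP: Pd1; rewrite Pd0 ?(ltnW duv) 1?eq_sym ?oner_eq0 // => w vw dw.
  by rewrite e_sym in vw; have := gdist_edge e_conn u vw; rewrite dw; lia.
by rewrite add0r -[RHS]addr0 => /addrI ->; rewrite duv ltn_eqF.
Qed.

Lemma generalized_odd_flat_edgeN d' : d = d'.+1 ->
  generalized_odd_graph e -> ~~ flat_edge e d'.
Proof.
move=> dE [[_ dr] og]; apply/negP => flat.
(* The flat edge yields an odd cycle of length at most [2 * d' + 1], and the odd-girth is twice the
   diameter plus one. *)
have Dd' : (diameter e <= d')%N.
  have [l [cl ol ll]] := flat_edge_cycle e_sym e_conn e_irr flat.
  by have [g []] := odd_girth_leq ol cl; rewrite og => -[<-]; lia.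
have [u0 [v0 [_ [_ duv0 _]]]] := flat_edgeP _ _ flat.
have gd u v : (gdist e u v <= d')%N := leq_trans (leq_diameter e u v) Dd'.
have d'D : (d' <= diameter e)%N by rewrite -duv0 leq_diameter.
have [t [PE tpos]] := predist_penultimate dE.
set tau := t (c_num e u0 v0).
have PE' u v : P d' u v = tau * (gdist e u v == d')%:R.
  rewrite PE; case: eqP => [duv|]; rewrite ?mulr0 // mulr1.
  by have [-> _ _] := dr d' d'D u v u0 v0 duv duv0.
have tau0 : tau != 0.
  by have := tpos u0 v0 u0 v0 duv0 duv0; apply: contraTneq => t0; rewrite -/tau t0 mul0r ltxx.
(* By the Hoffman identity [P d] vanishes below distance [d'] and equals [1 - tau] at [d']; being a
   multiple of the orthogonal [P d'], it would have norm zero. *)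
have Pd : P d = ((1 - tau) / tau) *: P d'.
  apply/matrixP => u v; rewrite mxE; have := sum_predist_entry u v dE; rewrite PE'.
  case: (ltngtP (gdist e u v) d') => duv.
  - by rewrite !mulr0 addr0 -[RHS]addr0 => /addrI.
  - by have := gd u v; rewrite leqNgt duv.
  - by rewrite add0r !mulr1 mulfVK // => /(canRL (addKr _)) ->; rewrite addrC.
have := frob_predist e_sym p_predist (leqnn d); rewrite {1}Pd frobZl.
rewrite (frob_predist0 e_sym p_predist) ?mulr0; [|lia..].
by move/esym/eqP; rewrite (negPf (predist_neq0 e_sym lam_spec p_predist _)).
Qed.

End PredistanceDistance.

(** * Distance-regularity from distance matrices that are polynomials in [A] *)

Section DistancePolynomials.

Variables (R : rcfType) (n : nat) (e : rel 'I_n.+1) (k d : nat).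
Variables (lam : 'I_d.+1 -> R) (p : nat -> {poly R}) (alpha beta gamma : nat -> R).
Hypotheses (e_sym : symmetric e) (e_conn : connected_graph e).
Hypothesis e_reg : forall v, #|[set w | e v w]| = k.
Hypothesis lam_spec : distinct_spectrum e lam.
Hypothesis p_predist : predistance_polynomials e lam p.
Hypothesis preint : preintersection_numbers lam p alpha beta gamma.
Hypothesis PD : forall i, (i <= d)%N -> horner_mx (adjmx R e) (p i) = distmx R e i.

(** The distance matrices of index at most [d] sum to the all-ones matrix, so they cover every
    pair. *)
Lemma gdist_leq_d u v : (gdist e u v <= d)%N.
Proof.
have /matrixP/(_ u v) := sum_predist e_sym e_conn e_reg lam_spec p_predist.
under eq_bigr => i _ do rewrite PD -1?ltnS //.
rewrite summxE [RHS]mxE; under eq_bigr do rewrite mxE.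
rewrite -(big_mkord predT (fun i => (gdist e u v == i)%:R)) sum_delta ltnS.
by case: leqP => // _ /esym/eqP; rewrite oner_eq0.
Qed.

Lemma diameter_predist : diameter e = d.
Proof.
apply/eqP; rewrite eqn_leq diameter_leq /=; last exact: gdist_leq_d.
have := predist_neq0 e_sym lam_spec p_predist (leqnn d).
rewrite -(frob_predist e_sym p_predist (leqnn d)) PD //; apply: contra_neqT.
rewrite -ltnNge => Dd; rewrite /frob big1 // => u _; rewrite big1 // => v _.
by rewrite !mxE ltn_eqF ?mulr0 // (leq_ltn_trans (leq_diameter e u v)).
Qed.

(** By the recurrence, [distmx j] times [A] is a combination of distance matrices, so its entries
    depend on the distance only. *)
Lemma sphere_num_gdist u v u' v' j : gdist e u v = gdist e u' v' ->
  sphere_num e u v j = sphere_num e u' v' j.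
Proof.
move=> duv; have [jd|dj] := leqP j d; last first.
  by rewrite /sphere_num !eq_card0 // => w; rewrite !inE ltn_eqF ?andbF // (leq_ltn_trans (gdist_leq_d _ _)).
apply/eqP; rewrite -(eqr_nat R) -!(mulmx_distmx_adjmx R e_sym) -PD //.
rewrite (recurrence_mx e_sym lam_spec preint jd); apply/eqP.
have PE i : (i <= d)%N -> horner_mx (adjmx R e) (p i) u v = horner_mx (adjmx R e) (p i) u' v'.
  by move=> id; rewrite PD // !mxE duv.
do 2!rewrite [in LHS]mxE [in RHS]mxE; congr (_ + _ + _).
- case: j jd => [|j] jd; first by rewrite !mxE.
  by rewrite [LHS]mxE [RHS]mxE PE // ltnW.
- by rewrite [LHS]mxE [RHS]mxE PE.
- by case: ifP => jd'; [rewrite [LHS]mxE [RHS]mxE PE|rewrite !mxE].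
Qed.

Lemma predist_distance_regular : distance_regular e.
Proof.
split=> // i _ u v u' v' duv duv'; have dd : gdist e u v = gdist e u' v' by rewrite duv.
rewrite !(a_numE duv) !(a_numE duv') !(b_numE duv) !(b_numE duv').
split; rewrite ?(sphere_num_gdist _ dd) //.
case: i duv duv' => [|i] duv duv'; first by rewrite !c_num0.
by rewrite (c_numE duv) (c_numE duv') (sphere_num_gdist _ dd).
Qed.

End DistancePolynomials.

(** * Consequences of the girth bound and the final equivalence *)

Lemma girth_flat_edgeN (T : finType) (e : rel T) d : symmetric e -> irreflexive e ->
  connected_graph e -> (forall g, girth e = Some g -> (2 * d - 2 <= g)%N) ->
  forall i, (i.+2 <= d)%N -> ~~ flat_edge e i.
Proof.
move=> e_sym e_irr e_conn gd i id; apply/negP => /(flat_edge_cycle e_sym e_conn e_irr).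
(* The cycle has length at most [2 * i + 1 <= 2 * d - 3]. *)
by case=> l [/girth_leq[g /gd gl lg] _]; lia.
Qed.

Lemma girth_c_num1 (T : finType) (e : rel T) d : symmetric e ->
  connected_graph e -> (forall g, girth e = Some g -> (2 * d - 2 <= g)%N) ->
  forall u v, (0 < gdist e u v)%N -> ((gdist e u v).+2 <= d)%N -> c_num e u v = 1%N.
Proof.
move=> e_sym e_conn gd u v; case duv: (gdist e u v) => [//|i] _ id.
apply/eqP; rewrite eqn_leq (c_num_gt0 e_sym e_conn duv) andbT leqNgt.
apply/negP => /card_gt1P[w [w' []]]; rewrite !inE duv !eqSS.
move=> /andP[vw /eqP dw] /andP[vw' /eqP dw'] ww'.
(* Two predecessors would close a cycle of length at most [2 * i.+1 <= 2 * d - 4]. *)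
have [l /girth_leq[g /gd gl lg]] := two_pred_cycle e_sym e_conn ww' vw vw' duv dw dw'.
by lia.
Qed.

Theorem theorem4p12 (R : rcfType) (n : nat) (e : rel 'I_n.+1)
  (d : nat) (lam : 'I_d.+1 -> R) (p : nat -> {poly R})
  (alpha beta gamma : nat -> R)
  (e_sym : symmetric e) (e_irr : irreflexive e)
  (e_conn : connected_graph e) (e_reg : regular_graph e)
  (lam_spec : distinct_spectrum e lam)
  (p_predist : predistance_polynomials e lam p)
  (preint : preintersection_numbers lam p alpha beta gamma)
  (girth_ge : forall g : nat, girth e = Some g -> (2 * d - 2 <= g)%N) :
  gamma d >= - (\sum_(i < d.+1 | i != ord0) lam i) /\
  (gamma d = - (\sum_(i < d.+1 | i != ord0) lam i) <->
     distance_regular e /\ (bipartite_graph e \/ generalized_odd_graph e)).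
Proof.
case: e_reg => k {}e_reg.
have no_flat := girth_flat_edgeN e_sym e_irr e_conn girth_ge.
have c_num1 := girth_c_num1 e_sym e_conn girth_ge.
(* For [d = 0] both sides of the inequality are 0, and all distances are 0, so the graph is a single
   vertex and bipartite. *)
case: (posnP d) => [d0|d_gt0].
  have sum0 : \sum_(i < d.+1 | i != ord0) lam i = 0.
    apply: big1 => i; case/eqP; apply: val_inj; have := ltn_ord i.
    by rewrite {2}d0 ltnS leqn0 => /eqP.
  have g0 : gamma d = 0 by rewrite d0; case: preint.
  have PD i : (i <= d)%N -> horner_mx (adjmx R e) (p i) = distmx R e i.
    by rewrite d0 leqn0 => /eqP->; apply: predist0_distmx p_predist.
  rewrite sum0 g0 oppr0 lexx; split=> //; split=> // _; split.
    exact: predist_distance_regular preint PD.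
  left; exists set0 => u v; have := gdist_leq_d e_sym e_conn e_reg lam_spec p_predist PD u v.
  by rewrite d0 leqn0 gdist_eq0 // => /eqP->; rewrite e_irr.
have dE : d = d.-1.+1 by rewrite prednK.
have gE := gamma_last e_sym e_conn e_reg lam_spec p_predist preint no_flat c_num1 dE.
have [a0 aE] := penultimate_alpha e_sym e_conn e_reg lam_spec p_predist preint no_flat c_num1 dE.
rewrite gE lerBrDr addNr; split=> //.
transitivity (alpha d.-1 = 0).
  by split=> [|->]; rewrite ?sub0r // => /eqP; rewrite -subr_eq0 opprK subrK => /eqP.
rewrite aE; split=> [noflat|[dr [bip|go]]].
- have PD := predist_distmx e_sym e_conn e_reg lam_spec p_predist preint no_flat c_num1 dE noflat.
  have dr := predist_distance_regular e_sym e_conn e_reg lam_spec p_predist preint PD.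
  (* All distances are at most [d], so either some flat edge yields an odd cycle of length at most
     [2 * d + 1], or there is no flat edge at all and the graph is bipartite. *)
  split=> //; case: (boolP [exists i : 'I_d.+1, flat_edge e i]) => [/existsP[i flat]|noflatd].
    right; split=> //; rewrite (diameter_predist e_sym e_conn e_reg lam_spec p_predist PD).
    have [l [cl ol ll]] := flat_edge_cycle e_sym e_conn e_irr flat.
    have [g [-> og cg gl]] := odd_girth_leq ol cl; congr Some.
    apply/eqP; rewrite eqn_leq; apply/andP; split.
      by have := ltn_ord i; lia.
    rewrite ltnNge; apply/negP => gd.
    (* An odd [g] below [2 * d + 1] is at most [2 * (d - 1) + 1], which forces a flat edge at a
       distance at most [d - 1], all of which are excluded. *)
    have g2 : (g <= (d.-1).*2.+1)%N by move: og; lia.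
    have [j jd flatj] := odd_cycle_flat_edge e_sym e_conn og cg g2.
    move: flatj; apply/negP; have [jd1|jd1] := eqVneq j d.-1; first by rewrite jd1.
    by apply: no_flat; lia.
  left; apply: (flat_edgeN_bipartite e_sym e_conn ord0) => i; apply/negP => flat.
  have [u [v [_ [_ duv _]]]] := flat_edgeP _ _ flat.
  have id : (i < d.+1)%N by rewrite ltnS -duv (gdist_leq_d e_sym e_conn e_reg lam_spec p_predist PD).
  by case/existsP: noflatd; exists (Ordinal id).
- exact: bipartite_flat_edge.
- exact: (generalized_odd_flat_edgeN e_sym e_irr e_conn e_reg lam_spec p_predist preint no_flat c_num1 dE go).
Qed.
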